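(* Let $A\in\{\mathbb{C},\mathbb{H},\mathbb{O}\}$ and let $\Omega\subseteq A$ be a circular set. If $f\in\mathcal{S}(\Omega)$, then for every $x\in\Omega$ the sets $\mathbb{S}_x\cap V(f)$ and $\mathbb{S}_x\cap V(f^c)$ are both empty, both singletons, or both equal to $\mathbb{S}_x$. Moreover, $$V(N(f))=\bigcup_{x\in V(f)}\mathbb{S}_x=\bigcup_{x\in V(f^c)}\mathbb{S}_x .$$ Finally, for all $g\in\mathcal{S}(\Omega)$, $$\bigcup_{x\in V(f\cdot g)}\mathbb{S}_x=\bigcup_{x\in V(f)\cup V(g)}\mathbb{S}_x .$$
   Context: $A$ is one of the real $*$-algebras $\mathbb{C},\mathbb{H},\mathbb{O}$ (complex numbers, quaternions, octonions) with standard conjugation $x\mapsto x^c$; $\mathbb{S}=\{w\in A: w^2=-1\}$; every $x\in A$ can be written $x=\alpha+\beta J$ with $\alpha,\beta\in\mathbb{R}$, $J\in\mathbb{S}$, and then $\mathbb{S}_x=\{\alpha+\beta I: I\in\mathbb{S}\}$ (so $\mathbb{S}_x=\{x\}$ if $x\in\mathbb{R}$). For nonempty $D\subseteq\mathbb{C}$ invariant under complex conjugation, $\Omega_D=\{\alpha+\beta J:\alpha,\beta\in\mathbb{R},\,J\in\mathbb{S},\,\alpha+i\beta\in D\}$; sets of this form are called circular. Let $\Omega=\Omega_D$. A function $f:\Omega\to A$ is a slice function if there are $F_1,F_2:D\to A$ with $F_1(\bar z)=F_1(z)$, $F_2(\bar z)=-F_2(z)$ and $f(\alpha+\beta J)=F_1(\alpha+i\beta)+JF_2(\alpha+i\beta)$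 for all $\alpha+i\beta\in D$, $J\in\mathbb{S}$ ($F_1,F_2$ are determined by $f$). $\mathcal{S}(\Omega)$ is the set of slice functions on $\Omega$. If $f,g$ correspond to $(F_1,F_2),(G_1,G_2)$, the slice product $f\cdot g$ corresponds to $(F_1G_1-F_2G_2,\;F_1G_2+F_2G_1)$ and the slice conjugate $f^c$ corresponds to $(F_1^c,F_2^c)$. The normal function is $N(f)=f\cdot f^c$. For a slice function $h$ on $\Omega$, $V(h)=\{x\in\Omega: h(x)=0\}$. *)

(* Defs.v *)
From HB Require Import structures.
From mathcomp Require Import all_boot all_order all_algebra.
From mathcomp Require Import ring lra.
From mathcomp Require Import boolp classical_sets reals complex.
Set Implicit Arguments.
Unset Strict Implicit.
Unset Printing Implicit Defensive.
Import Order.TTheory GRing.Theory Num.Theory.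
Local Open Scope ring_scope.
Local Open Scope complex_scope.
Local Open Scope classical_set_scope.

(* Real unital star-algebras; the product need not be associative, so the
   ring structures of the library do not apply. *)
HB.mixin Record Lmodule_isStarAlgebra (R : realType) A
    of GRing.Lmodule R A := {
  sone : A;
  smul : A -> A -> A;
  sconj : A -> A;
  sone_neq0 : sone != 0;
  smul1l : left_id sone smul;
  smul1r : right_id sone smul;
  smulPl : forall (a : R) (x x' y : A),
    smul (a *: x + x') y = a *: smul x y + smul x' y;
  smulPr : forall (a : R) (x y y' : A),
    smul x (a *: y + y') = a *: smul x y + smul x y';
  sconjP : forall (a : R) (x y : A), sconj (a *: x + y) = a *: sconj x + sconj y;
  sconjK : involutive sconj;
  sconjM : forall x y : A, sconj (smul x y) = smul (sconj y) (sconj x) }.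

#[short(type="starAlgType")]
HB.structure Definition StarAlgebra (R : realType) :=
  { A of Lmodule_isStarAlgebra R A & GRing.Lmodule R A }.

Declare Scope star_scope.
Delimit Scope star_scope with star.
Notation "x ** y" := (smul x y) (at level 40, left associativity) : star_scope.
Notation "x ^c" := (sconj x) : star_scope.
Local Open Scope star_scope.

Section StarTheory.
Variables (R : realType) (A : starAlgType R).
Implicit Types (x y : A) (a : R).

Lemma smul0l y : 0 ** y = 0.
Proof.
have := smulPl 1%R 0 0 y; rewrite !scale1r addr0 => /eqP.
by rewrite -subr_eq0 opprD addrA subrr sub0r oppr_eq0 => /eqP.
Qed.
Lemma smul0r y : y ** 0 = 0.
Proof.
have := smulPr 1%R y 0 0; rewrite !scale1r addr0 => /eqP.
by rewrite -subr_eq0 opprD addrA subrr sub0r oppr_eq0 => /eqP.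
Qed.
Lemma sconj0 : 0^c = 0 :> A.
Proof.
have := sconjP 1%R (0 : A) 0; rewrite !scale1r addr0 => /eqP.
by rewrite -subr_eq0 opprD addrA subrr sub0r oppr_eq0 => /eqP.
Qed.
Lemma smulDl x x' y : (x + x') ** y = x ** y + x' ** y.
Proof. by have := smulPl 1%R x x' y; rewrite !scale1r. Qed.
Lemma smulDr x y y' : x ** (y + y') = x ** y + x ** y'.
Proof. by have := smulPr 1%R x y y'; rewrite !scale1r. Qed.
Lemma sconjD x y : (x + y)^c = x^c + y^c.
Proof. by have := sconjP 1%R x y; rewrite !scale1r. Qed.
Lemma smulZl a x y : (a *: x) ** y = a *: (x ** y).
Proof. by have := smulPl a x 0 y; rewrite smul0l !addr0. Qed.
Lemma smulZr a x y : x ** (a *: y) = a *: (x ** y).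
Proof. by have := smulPr a x y 0; rewrite smul0r !addr0. Qed.
Lemma sconjZ a x : (a *: x)^c = a *: x^c.
Proof. by have := sconjP a x 0; rewrite sconj0 !addr0. Qed.
Lemma smulNl x y : (- x) ** y = - (x ** y).
Proof. by rewrite -scaleN1r smulZl scaleN1r. Qed.
Lemma smulNr x y : x ** (- y) = - (x ** y).
Proof. by rewrite -scaleN1r smulZr scaleN1r. Qed.
Lemma sconjN x : (- x)^c = - x^c.
Proof. by rewrite -scaleN1r sconjZ scaleN1r. Qed.
Lemma sconj1 : sone^c = sone :> A.
Proof.
have := sconjM (sone^c : A) sone; rewrite smul1r sconjK => E.
by rewrite [RHS]E smul1r.
Qed.
End StarTheory.

(* [Rcomplex R] is the library's copy of [R[i]] with scalars in [R]. *)
Section ComplexStar.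
Variable R : realType.
Implicit Types x y : Rcomplex R.
Let cone : Rcomplex R := 1%R.
Let cmul x y : Rcomplex R := (x * y)%R.
Let cconj x : Rcomplex R := conjc x.
Let cone_neq0 : cone != 0. Proof. exact: oner_neq0. Qed.
Let cmul1l : left_id cone cmul. Proof. exact: mul1r. Qed.
Let cmul1r : right_id cone cmul. Proof. exact: mulr1. Qed.
Let cmulPl (a : R) x x' y : cmul (a *: x + x') y = a *: cmul x y + cmul x' y.
Proof. by rewrite /cmul mulrDl scalerAl. Qed.
Let cmulPr (a : R) x y y' : cmul x (a *: y + y') = a *: cmul x y + cmul x y'.
Proof. by rewrite /cmul mulrDr mulrC -scalerAl [y * x]mulrC. Qed.
Let cconjP (a : R) x y : cconj (a *: x + y) = a *: cconj x + cconj y.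
Proof.
case: x y => [x1 x2] [y1 y2].
by congr Complex; rewrite /= opprD mulrN.
Qed.
Let cconjK : involutive cconj. Proof. exact: conjcK. Qed.
Let cconjM x y : cconj (cmul x y) = cmul (cconj y) (cconj x).
Proof. by rewrite /cconj /cmul rmorphM mulrC. Qed.
HB.instance Definition _ := Lmodule_isStarAlgebra.Build R (Rcomplex R)
  cone_neq0 cmul1l cmul1r cmulPl cmulPr cconjP cconjK cconjM.
End ComplexStar.

(* The Cayley-Dickson double of [A]: the pair [(a, b)] stands for [a + b l]. *)
Definition double (R : realType) (A : starAlgType R) : Type := (A * A)%type.

Section Double.
Variables (R : realType) (A : starAlgType R).
HB.instance Definition _ := GRing.Lmodule.copy (double A) (A * A)%type.
Implicit Types x y : double A.
Let done1 : double A := (sone : A, 0 : A).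
Definition double_mul x y : double A :=
  (x.1 ** y.1 - y.2^c ** x.2, y.2 ** x.1 + x.2 ** y.1^c).
Definition double_conj x : double A := (x.1^c, - x.2).
Let done_neq0 : done1 != 0.
Proof. by apply/eqP => -[/eqP]; apply/negP; exact: sone_neq0. Qed.
Let dmul1l : left_id done1 double_mul.
Proof.
by move=> [a b]; rewrite /double_mul /= smul1l smul1r smul0r smul0l subr0 addr0.
Qed.
Let dmul1r : right_id done1 double_mul.
Proof.
move=> [a b]; rewrite /double_mul /= smul1r sconj0 sconj1 smul0l smul1r.
by rewrite smul0l subr0 add0r.
Qed.
Let dmulPl (a : R) x x' y :
  double_mul (a *: x + x') y = a *: double_mul x y + double_mul x' y.
Proof.
apply/pair_equal_spec; split => /=.
- by rewrite smulPl smulPr scalerBr opprD !addrA; congr (_ + _); rewrite addrAC.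
- by rewrite smulPl smulPr scalerDr !addrA; congr (_ + _); rewrite addrAC.
Qed.
Let dmulPr (a : R) x y y' :
  double_mul x (a *: y + y') = a *: double_mul x y + double_mul x y'.
Proof.
apply/pair_equal_spec; split => /=.
- rewrite sconjP smulPl smulPr scalerBr opprD !addrA; congr (_ + _).
  by rewrite addrAC.
- rewrite sconjP smulPl smulPr scalerDr !addrA; congr (_ + _).
  by rewrite addrAC.
Qed.
Let dconjP (a : R) x y : double_conj (a *: x + y) = a *: double_conj x + double_conj y.
Proof. by apply/pair_equal_spec; split => /=; rewrite ?sconjP // opprD scalerN. Qed.
Let dconjK : involutive double_conj.
Proof. by move=> [a b]; rewrite /double_conj /= sconjK opprK. Qed.
Let dconjM x y : double_conj (double_mul x y) = double_mul (double_conj y) (double_conj x).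
Proof.
apply/pair_equal_spec; split => /=.
- by rewrite sconjD !sconjN !sconjM sconjK smulNl smulNr opprK.
- by rewrite !smulNl sconjK opprD addrC.
Qed.
HB.instance Definition _ := Lmodule_isStarAlgebra.Build R (double A)
  done_neq0 dmul1l dmul1r dmulPl dmulPr dconjP dconjK dconjM.
End Double.

Definition quaternion (R : realType) : starAlgType R := double (Rcomplex R).
Definition octonion (R : realType) : starAlgType R := double (quaternion R).

Inductive CHO := Complexes | Quaternions | Octonions.

Definition CHO_alg (R : realType) (k : CHO) : starAlgType R :=
  match k with
  | Complexes => Rcomplex R
  | Quaternions => quaternion R
  | Octonions => octonion R
  end.

(* Functions on [D] and on its circularization are represented by total
   functions; only their values on these sets matter. *)
Section Slice.
Variables (R : realType) (A : starAlgType R).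
Implicit Types (D : set R[i]) (f g h : A -> A).

Definition polar (a b : R) (J : A) : A := a *: sone + b *: J.

(* The set of imaginary units of [A]. *)
Definition imunit : set A := [set w | w ** w = - sone].

(* The sphere of [x = a + b J]; it is [[set x]] when [x] is real ([b = 0]). *)
Definition sphere (x : A) : set A :=
  [set y | exists (a b : R) (J I : A),
     [/\ imunit J, imunit I, x = polar a b J & y = polar a b I]].

Definition conj_invariant D := forall z, D z -> D (z^*).

Definition circ D : set A :=
  [set x | exists (a b : R) (J : A),
     [/\ imunit J, D (a +i* b) & x = polar a b J]].

Definition stem : Type := ((R[i] -> A) * (R[i] -> A))%type.
Implicit Types F G : stem.

Definition is_stem D F :=
  forall z, D z -> F.1 (z^*) = F.1 z /\ F.2 (z^*) = - F.2 z.

Definition induces D F f :=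
  forall (a b : R) (J : A), D (a +i* b) -> imunit J ->
    f (polar a b J) = F.1 (a +i* b) + J ** F.2 (a +i* b).

Definition is_slice D f := exists F, is_stem D F /\ induces D F f.

Definition stem_of D f : stem :=
  xget (fun=> 0, fun=> 0) [set F | is_stem D F /\ induces D F f].

Definition slice_of D F : A -> A := xget (fun=> 0) [set h | induces D F h].

Definition stem_mul F G : stem :=
  (fun z => F.1 z ** G.1 z - F.2 z ** G.2 z,
   fun z => F.1 z ** G.2 z + F.2 z ** G.1 z).

Definition stem_conj F : stem := (fun z => (F.1 z)^c, fun z => (F.2 z)^c).

Definition slice_mul D f g : A -> A :=
  slice_of D (stem_mul (stem_of D f) (stem_of D g)).

Definition slice_conj D f : A -> A := slice_of D (stem_conj (stem_of D f)).

Definition normal D f : A -> A := slice_mul D f (slice_conj D f).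

(* Restricted to the domain, as [f] is only meaningful on [circ D]. *)
Definition zeros D f : set A := [set x | circ D x /\ f x = 0].

(* The default values of [xget] above are never reached: [stem_ofP] and
   [slice_ofP] show that the chosen objects have the required property. *)

Lemma stem_ofP D f : is_slice D f ->
  is_stem D (stem_of D f) /\ induces D (stem_of D f) f.
Proof. by move=> sf; rewrite /stem_of; case: xgetP => // /(_ _ _) H; case: sf => F /H. Qed.

Lemma imunit_nonreal (r : R) : ~ imunit (r *: sone).
Proof.
rewrite /imunit /= smulZl smulZr smul1l scalerA => /eqP.
rewrite -subr_eq0 opprK -[X in _ + X]scale1r -scalerDl scaler_eq0.
rewrite (negbTE (@sone_neq0 R A)) orbF => /eqP H.
have := sqr_ge0 r; rewrite expr2; lra.
Qed.

Lemma polar_uniq (a b a' b' : R) (J J' : A) : imunit J -> imunit J' ->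
  polar a b J = polar a' b' J' -> a = a' /\ b *: J = b' *: J'.
Proof.
move=> uJ uJ' E.
suff H : a = a' by split => //; move: E; rewrite H => /addrI.
(* x^2 = 2 a x - (a^2 + b^2) for x = a + b J *)
have sq (c d : R) (K : A) : imunit K ->
    (polar c d K) ** (polar c d K) =
    (2%:R * c) *: (polar c d K) - (c ^+ 2 + d ^+ 2) *: sone.
  rewrite /imunit /polar /= => uK.
  rewrite smulDl !smulDr !smulZl !smulZr !smul1l smul1r uK.
  rewrite !scalerDr !scalerA scalerN [d * c]mulrC.
  have -> : (2%:R * c * c) = c * c + c * c by ring.
  have -> : (2%:R * c * d) = c * d + c * d by ring.
  rewrite !scalerDl opprD !expr2 -!addrA; congr (_ + _).
  rewrite [RHS]addrC -!addrA; congr (_ + _); congr (_ + _).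
  by rewrite addrC -!addrA addrN addr0.
have swap (X Y C C' : A) : X - C' = Y - C -> X - Y = C' - C.
  by move=> H; rewrite -(subrK C' X) H [LHS]addrC !addrA addNr add0r addrC.
have := sq a b _ uJ; rewrite {1 2}E (sq a' b' _ uJ') -E => /swap.
rewrite -!scalerBl => E2.
case: (eqVneq a a') => // neq; exfalso.
set k := (2%:R * a' - 2%:R * a) in E2.
have k0 : k != 0.
  by rewrite /k -mulrBr mulf_neq0 ?pnatr_eq0 // subr_eq0 eq_sym.
have xreal (c d : R) (K : A) : imunit K ->
    (exists s : R, polar c d K = s *: sone) -> d = 0.
  move=> uK [s Es]; case: (eqVneq d 0) => // d0; exfalso.
  apply: (@imunit_nonreal ((s - c) / d)).
  suff <- : K = ((s - c) / d) *: sone by [].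
  by rewrite mulrC -scalerA scalerBl -Es /polar addrAC subrr add0r scalerA mulVf ?scale1r.
have real : exists s : R, polar a b J = s *: sone.
  exists (k^-1 * (a' ^+ 2 + b' ^+ 2 - (a ^+ 2 + b ^+ 2))).
  by rewrite -scalerA -E2 scalerA mulVf // scale1r.
have b0 := xreal _ _ _ uJ real.
have b'0 : b' = 0 by apply: (xreal a' _ J') => //; case: real => s Hs; exists s; rewrite -E.
move/eqP: E; rewrite /polar b0 b'0 !scale0r !addr0 -subr_eq0 -scalerBl scaler_eq0.
by rewrite (negbTE (@sone_neq0 R A)) orbF subr_eq0 (negbTE neq).
Qed.

Lemma slice_ofP D F : is_stem D F -> induces D F (slice_of D F).
Proof.
move=> sF; rewrite /slice_of; case: xgetP => // none; exfalso.
have wd (a b a' b' : R) (J J' : A) : imunit J -> imunit J' ->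
    D (a +i* b) -> D (a' +i* b') -> polar a b J = polar a' b' J' ->
    F.1 (a +i* b) + J ** F.2 (a +i* b) = F.1 (a' +i* b') + J' ** F.2 (a' +i* b').
  move=> uJ uJ' Dz Dz' /(polar_uniq uJ uJ')[eqa E]; subst a'.
  have b2 : b ^+ 2 = b' ^+ 2.
    have : (b *: J) ** (b *: J) = (b' *: J') ** (b' *: J') by rewrite E.
    rewrite !smulZl !smulZr uJ uJ' !scalerA => /eqP.
    rewrite -subr_eq0 -scalerBl scaler_eq0 oppr_eq0 (negbTE (@sone_neq0 R A)).
    by rewrite orbF subr_eq0 -!expr2 => /eqP.
  case: (eqVneq b 0) => [b0|bn0].
    have b'0 : b' = 0 by apply/eqP; rewrite -sqrf_eq0 -b2 b0 expr0n.
    subst b b'; have [_] := sF _ Dz; rewrite /= oppr0 => /eqP.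
    rewrite -subr_eq0 opprK -mulr2n -scaler_nat scaler_eq0 pnatr_eq0 /=.
    by move=> /eqP ->; rewrite !smul0r.
  move/eqP: b2; rewrite eqf_sqr => /orP[] /eqP Eb.
    by subst b'; move/(scalerI bn0): E => ->.
  have Eb' : b' = - b by rewrite Eb opprK.
  subst b'; have [] := sF _ Dz => /= -> ->.
  have -> : J' = - J by apply: (scalerI bn0); rewrite scalerN E scaleNr opprK.
  by rewrite smulNl smulNr opprK.
pose P (x y : A) := exists (a b : R) (J : A),
  [/\ imunit J, D (a +i* b), x = polar a b J
    & y = F.1 (a +i* b) + J ** F.2 (a +i* b)].
apply: (none (fun x => xget 0 [set y | P x y])) => a b J Dz uJ.
case: xgetP => [y _ [a' [b' [J' [uJ' Dz' E ->]]]]|].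
  exact/esym/wd.
by move=> /(_ (F.1 (a +i* b) + J ** F.2 (a +i* b))) []; exists a, b, J.
Qed.

End Slice.

(* Main.v *)
(* The algebras C, H, O carry a multiplicative norm [q] with polar form [pol];
   this is transported along the Cayley-Dickson construction, [q (a, b)] being
   [q a + q b].  An element [J] is an imaginary unit exactly when [q J = 1] and
   [J] has trace 0, so solving [x + J y = 0] for [y <> 0] shows that a slice
   function with stem [(F1, F2)] vanishes somewhere on the sphere of [a + b J]
   iff [q F1 - q F2 + i pol F1 F2 = 0] at [a + i b]; the root is then unique
   unless [F2 = 0], in which case [F1 = 0] as well.  This complex number is the
   norm of [F1 + i F2] in the complexified algebra.  It is invariant under
   conjugation and multiplicative, and its real and imaginary parts form the
   stem of the normal function, whence all the claims. *)
Require Import Defs.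
From HB Require Import structures.
From mathcomp Require Import all_boot all_order all_algebra.
From mathcomp Require Import ring lra.
From mathcomp Require Import boolp classical_sets reals complex.
Set Implicit Arguments.
Unset Strict Implicit.
Unset Printing Implicit Defensive.
Import Order.TTheory GRing.Theory Num.Theory.
Local Open Scope ring_scope.
Local Open Scope complex_scope.
Local Open Scope classical_set_scope.
Local Open Scope star_scope.

(** * Multiplicative norms and their polar forms *)

Record multiplicative_norm (R : realType) (A : starAlgType R) (q : A -> R) :
    Prop := MultiplicativeNorm {
  norm_ge0 : forall x, 0 <= q x;
  norm_eq0 : forall x, q x = 0 -> x = 0;
  normM : forall x y, q (x ** y) = q x * q y;
  norm_conj : forall x, q (x^c) = q x;
  smulK_conj : forall x y, (x ** y) ** y^c = q y *: x }.

Section MultiplicativeNorm.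
Variables (R : realType) (A : starAlgType R) (q : A -> R).
Hypothesis qP : multiplicative_norm q.
Implicit Types (x y z w J : A) (a b : R).

(** Identities between reals are proved below by comparing multiples of [sone] in [A]. *)
Lemma scale_sone_inj : injective (fun a => a *: (sone : A)).
Proof.
move=> a b /= /eqP; rewrite -subr_eq0 -scalerBl scaler_eq0.
by rewrite (negbTE (@sone_neq0 R A)) orbF subr_eq0 => /eqP.
Qed.

Lemma normE x : q x *: sone = x ** x^c.
Proof. by rewrite -(smulK_conj qP) smul1l. Qed.

Lemma smul_conjK x y : (x ** y^c) ** y = q y *: x.
Proof. by rewrite -{2}[y]sconjK (smulK_conj qP) (norm_conj qP). Qed.

Lemma norm0 : q 0 = 0.
Proof. by apply: scale_sone_inj; rewrite /= normE smul0l scale0r. Qed.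

Lemma normZ a x : q (a *: x) = a ^+ 2 * q x.
Proof.
apply: scale_sone_inj; rewrite /= normE sconjZ smulZl smulZr -normE !scalerA.
by rewrite expr2.
Qed.

Definition pol x y : R := q (x + y) - q x - q y.

Lemma polE x y : pol x y *: sone = x ** y^c + y ** x^c.
Proof.
rewrite /pol !scalerBl !normE sconjD smulDl !smulDr addrAC.
by rewrite (addrA (_ + _)) addrK -(addrA (x ** _)) addrC addKr.
Qed.

Lemma polC x y : pol x y = pol y x.
Proof. by apply: scale_sone_inj; rewrite /= !polE addrC. Qed.

Lemma polDl x y z : pol (x + y) z = pol x z + pol y z.
Proof.
apply: scale_sone_inj; rewrite /= [RHS]scalerDl !polE sconjD smulDl smulDr.
by rewrite addrACA.
Qed.

Lemma polZl a x y : pol (a *: x) y = a * pol x y.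
Proof.
apply: scale_sone_inj; rewrite /= -scalerA !polE sconjZ smulZl smulZr.
by rewrite scalerDr.
Qed.

Lemma polNl x y : pol (- x) y = - pol x y.
Proof. by rewrite -scaleN1r polZl mulN1r. Qed.

Lemma polDr x y z : pol x (y + z) = pol x y + pol x z.
Proof. by rewrite polC polDl !(polC x). Qed.

Lemma polNr x y : pol x (- y) = - pol x y.
Proof. by rewrite polC polNl polC. Qed.

Lemma normN x : q (- x) = q x.
Proof. by rewrite -scaleN1r normZ expr2 mulrNN !mul1r. Qed.

Lemma normD x y : q (x + y) = q x + q y + pol x y.
Proof. rewrite /pol; ring. Qed.

Lemma pol_conj x y : pol (x^c) (y^c) = pol x y.
Proof. by rewrite /pol -sconjD !(norm_conj qP). Qed.

Lemma polMr x y z : pol (x ** z) (y ** z) = pol x y * q z.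
Proof. by rewrite /pol -smulDl !(normM qP); ring. Qed.

Lemma polMl x y z : pol (z ** x) (z ** y) = q z * pol x y.
Proof. by rewrite /pol -smulDr !(normM qP); ring. Qed.

(** Second linearization of [normM]: the cross terms of [polMr] at [z + w]. *)
Lemma polMM x y z w :
  pol (x ** z) (y ** w) + pol (x ** w) (y ** z) = pol x y * pol z w.
Proof.
have := polMr x y (z + w); rewrite !smulDr polDl !polDr !polMr normD => H; lra.
Qed.

Lemma sconj_trace x : x^c = pol x sone *: sone - x.
Proof. by rewrite polE sconj1 smul1r smul1l addrC addKr. Qed.

Lemma imunit_normP J : imunit J <-> q J = 1 /\ pol J sone = 0.
Proof.
(* Cayley-Hamilton; a nonzero trace would make [J] real. *)
have sq : J ** J = pol J sone *: J - q J *: sone.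
  rewrite normE sconj_trace smulDr smulZr smul1r smulNr.
  by rewrite opprD opprK addrA subrr add0r.
split=> [uJ|[q1 t0]]; last by rewrite /imunit /= sq q1 t0 scale0r scale1r sub0r.
have E : pol J sone *: J = (q J - 1) *: sone.
  by rewrite [RHS]scalerBl scale1r -uJ sq addrC subrK.
have t0 : pol J sone = 0.
  apply/eqP/negPn/negP => t0.
  apply: (@imunit_nonreal R A ((pol J sone)^-1 * (q J - 1))).
  by rewrite -scalerA -E scalerA mulVf // scale1r.
split=> //; move: E; rewrite t0 scale0r -(scale0r sone) => /scale_sone_inj /eqP.
by rewrite eq_sym subr_eq0 => /eqP.
Qed.

Lemma smul_eq0 x y : x ** y = 0 -> x = 0 \/ y = 0.
Proof.
move=> xy0; have := normM qP x y; rewrite xy0 norm0 => /esym/eqP.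
by rewrite mulf_eq0 => /orP[] /eqP /(norm_eq0 qP); [left|right].
Qed.

(* [q x - q y + i * pol x y] is the complexified norm of [x + i y]. *)
Definition null x y := q x = q y /\ pol x y = 0.

Lemma null_conj x y : null (x^c) (y^c) <-> null x y.
Proof. by rewrite /null pol_conj !(norm_conj qP). Qed.

(** The complexified norms multiply as complex numbers. Taking squared moduli turns the two
    equations of [null] into a single real one. *)
Lemma nullM x y z w :
  null (x ** z - y ** w) (x ** w + y ** z) <-> null x y \/ null z w.
Proof.
have null2 x' y' : null x' y' <-> (q x' - q y') ^+ 2 + pol x' y' ^+ 2 = 0.
  split=> [[-> ->]|/eqP]; first by rewrite subrr expr0n addr0.
  by rewrite paddr_eq0 ?sqr_ge0 // !sqrf_eq0 subr_eq0 => /andP[/eqP ? /eqP].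
rewrite !null2.
(* Real and imaginary parts of the product of the two complexified norms. *)
have -> : q (x ** z - y ** w) - q (x ** w + y ** z) =
    (q x - q y) * (q z - q w) - pol x y * pol z w.
  by rewrite !normD normN polNr !(normM qP) -polMM; ring.
have -> : pol (x ** z - y ** w) (x ** w + y ** z) =
    (q x - q y) * pol z w + pol x y * (q z - q w).
  by rewrite polDl polNl !polDr !polMl !polMr (polC y) (polC w); ring.
(* Brahmagupta's two-square identity. *)
have -> (a b c d : R) : (a * c - b * d) ^+ 2 + (a * d + b * c) ^+ 2 =
    (a ^+ 2 + b ^+ 2) * (c ^+ 2 + d ^+ 2) by ring.
split=> [/eqP|[] ->]; rewrite ?mul0r ?mulr0 //.
by rewrite mulf_eq0 => /orP[] /eqP; [left|right].
Qed.

Lemma null_root x y J : imunit J -> x + J ** y = 0 -> null x y.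
Proof.
move=> /imunit_normP[J1 J0] /eqP; rewrite addr_eq0 => /eqP ->; split.
  by rewrite normN (normM qP) J1 mul1r.
by rewrite polNl -{2}[y]smul1l polMr J0 mul0r oppr0.
Qed.

Lemma null_ex_root x y : null x y -> y != 0 ->
  exists2 J, imunit J & x + J ** y = 0.
Proof.
move=> [qxy txy] y0; have qy0 : q y != 0.
  by apply: contra_neq y0 => /(norm_eq0 qP).
(* This is [- x] times the inverse [y^c / q y] of [y]; [smul_conjK] makes it a root without
   associativity. *)
exists (- ((q y)^-1 *: (x ** y^c))).
  apply/imunit_normP; split.
    rewrite normN normZ (normM qP) (norm_conj qP) qxy.
    by rewrite -expr2 -exprMn mulVf // expr1n.
  rewrite polNl polZl.
  have -> : pol (x ** y^c) sone = pol x y.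
    by apply: scale_sone_inj; rewrite /= !polE sconj1 smul1r smul1l sconjM sconjK.
  by rewrite txy mulr0 oppr0.
by rewrite smulNl smulZl smul_conjK scalerA mulVf // scale1r subrr.
Qed.

Lemma null0 x : null x 0 -> x = 0.
Proof. by case; rewrite norm0 => /(norm_eq0 qP). Qed.

End MultiplicativeNorm.

(** * Stems of slice functions and their zeros on spheres *)

Section SliceOperations.
Variables (R : realType) (A : starAlgType R).
Implicit Types (D : set R[i]) (F G : stem A) (f g : A -> A).

Lemma is_stem_mul D F G : is_stem D F -> is_stem D G -> is_stem D (stem_mul F G).
Proof.
move=> sF sG z Dz; have [F1 F2] := sF z Dz; have [G1 G2] := sG z Dz.
by rewrite /= F1 F2 G1 G2 !smulNl !smulNr opprK opprD.
Qed.

Lemma is_stem_conj D F : is_stem D F -> is_stem D (stem_conj F).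
Proof.
by move=> sF z Dz; have [F1 F2] := sF z Dz; rewrite /= F1 F2 sconjN.
Qed.

Lemma slice_mulP D f g : is_slice D f -> is_slice D g ->
  is_stem D (stem_mul (stem_of D f) (stem_of D g)) /\
  induces D (stem_mul (stem_of D f) (stem_of D g)) (slice_mul D f g).
Proof.
move=> /stem_ofP[sF _] /stem_ofP[sG _].
by have sFG := is_stem_mul sF sG; split; [|exact: slice_ofP].
Qed.

Lemma slice_conjP D f : is_slice D f ->
  is_stem D (stem_conj (stem_of D f)) /\
  induces D (stem_conj (stem_of D f)) (slice_conj D f).
Proof.
move=> /stem_ofP[sF _].
by have sFc := is_stem_conj sF; split; [|exact: slice_ofP].
Qed.

Lemma imunitN (J : A) : imunit J -> imunit (- J).
Proof. by rewrite /imunit /= smulNl smulNr opprK. Qed.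

(** A polar form determines [a], but [b] only up to a sign, which is absorbed by passing from [I] to
    [- I]. *)
Lemma sphere_polar (a b : R) (J : A) : imunit J ->
  sphere (polar a b J) = [set polar a b I | I in @imunit R A].
Proof.
move=> uJ; rewrite predeqE => y.
split=> [[a' [b' [J' [I [uJ' uI E ->]]]]]|[I uI <-]].
  have [<- bJ] := polar_uniq uJ uJ' E.
  have : b ^+ 2 = b' ^+ 2.
    have /eqP : (b *: J) ** (b *: J) = (b' *: J') ** (b' *: J') by rewrite bJ.
    rewrite !smulZl !smulZr uJ uJ' !scalerA.
    rewrite -subr_eq0 -scalerBl scaler_eq0 oppr_eq0 (negbTE (@sone_neq0 R A)).
    by rewrite orbF subr_eq0 -!expr2 => /eqP.
  move=> /eqP; rewrite eqf_sqr => /orP[] /eqP ->; first by exists I.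
  by exists (- I); [exact: imunitN|rewrite /polar scalerN scaleNr opprK].
by exists a, b, J, I.
Qed.

Variable q : A -> R.
Hypothesis qP : multiplicative_norm q.

(** [stem_of] makes a choice, so the stem chosen for a slice conjugate must be identified with the
    explicit one. *)
Lemma stem_uniq D F G f (a b : R) (J : A) : induces D F f -> induces D G f ->
  imunit J -> D (a +i* b) ->
  F.1 (a +i* b) = G.1 (a +i* b) /\ F.2 (a +i* b) = G.2 (a +i* b).
Proof.
move=> iF iG uJ Dz; set z := a +i* b.
have E (I : A) : imunit I -> (F.1 z - G.1 z) + I ** (F.2 z - G.2 z) = 0.
  move=> uI; rewrite smulDr smulNr addrACA -opprD -iF // -iG //.
  exact: subrr.
have d1 : F.1 z - G.1 z = 0.
  (* Adding the equations at [J] and [- J] leaves twice the difference of the first components. *)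
  have := congr2 +%R (E J uJ) (E (- J) (imunitN uJ)).
  rewrite smulNl addrACA subrr !addr0 -mulr2n -scaler_nat => /eqP.
  by rewrite scaler_eq0 pnatr_eq0 => /eqP.
have := E J uJ; rewrite d1 add0r => /(smul_eq0 qP) [J0|/eqP].
  have /(imunit_normP qP)[] := uJ; rewrite J0 (norm0 qP) => /eqP.
  by rewrite eq_sym oner_eq0.
by rewrite subr_eq0 => /eqP ->; split=> //; apply/eqP; rewrite -subr_eq0 d1.
Qed.

(** All the unions of spheres in the theorem are compared through this set, which depends on the
    stem alone. *)
Definition null_spheres D F : set A :=
  [set x | exists (a b : R) (J : A), [/\ imunit J, D (a +i* b), x = polar a b J
    & null q (F.1 (a +i* b)) (F.2 (a +i* b))]].

Lemma sphere_zeros D F f (a b : R) (J : A) : induces D F f -> imunit J ->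
  D (a +i* b) -> sphere (polar a b J) `&` zeros D f =
    [set polar a b I | I in [set I | imunit I /\
       F.1 (a +i* b) + I ** F.2 (a +i* b) = 0]].
Proof.
move=> iF uJ Dz; rewrite sphere_polar // predeqE => y; split.
  by case=> -[I uI <-] [_]; rewrite iF // => fI; exists I.
case=> I [uI fI] <-; split; first by exists I.
by split; [exists a, b, I|rewrite iF].
Qed.

Lemma null_exists_root F (a b : R) (J : A) : imunit J ->
  null q (F.1 (a +i* b)) (F.2 (a +i* b)) ->
  exists2 I : A, imunit I & F.1 (a +i* b) + I ** F.2 (a +i* b) = 0.
Proof.
move=> uJ nF; have [F20|] := eqVneq (F.2 (a +i* b)) 0; last first.
  exact: (null_ex_root qP nF).
by exists J => //; move: nF; rewrite F20 smul0r addr0 => /(null0 qP).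
Qed.

(** [null] does not involve the unit: one zero marks its whole sphere, and a marked sphere has a
    zero, possibly at another unit. *)
Lemma bigcup_sphere_zeros D F f : induces D F f ->
  \bigcup_(x in zeros D f) sphere x = null_spheres D F.
Proof.
move=> iF; rewrite predeqE => y; split.
  case=> _ [[a [b [J [uJ Dz ->]]]]]; rewrite iF // => /(null_root qP uJ) nF.
  by rewrite sphere_polar // => -[I uI <-]; exists a, b, I.
case=> a [b [J [uJ Dz -> nF]]]; have [I uI fI] := null_exists_root uJ nF.
exists (polar a b I); last by rewrite sphere_polar //; exists J.
by split; [exists a, b, I|rewrite iF].
Qed.

Lemma sphere_zeros_empty D F f (a b : R) (J : A) : induces D F f ->
  imunit J -> D (a +i* b) -> ~ null q (F.1 (a +i* b)) (F.2 (a +i* b)) ->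
  sphere (polar a b J) `&` zeros D f = set0.
Proof.
move=> iF uJ Dz nF; rewrite (sphere_zeros iF) // -subset0.
by move=> y [I [uI /(null_root qP uI)]].
Qed.

Lemma sphere_zeros_full D F f (a b : R) (J : A) : induces D F f ->
  imunit J -> D (a +i* b) -> null q (F.1 (a +i* b)) (F.2 (a +i* b)) ->
  F.2 (a +i* b) = 0 ->
  sphere (polar a b J) `&` zeros D f = sphere (polar a b J).
Proof.
move=> iF uJ Dz + F2; rewrite (sphere_zeros iF) // sphere_polar // F2.
move=> /(null0 qP) ->; rewrite predeqE => y.
split=> -[I]; first by case=> uI _ <-; exists I.
by move=> uI <-; exists I => //; rewrite /= smul0r addr0.
Qed.

Lemma sphere_zeros_singleton D F f (a b : R) (J : A) : induces D F f ->
  imunit J -> D (a +i* b) -> null q (F.1 (a +i* b)) (F.2 (a +i* b)) ->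
  F.2 (a +i* b) != 0 ->
  exists y, sphere (polar a b J) `&` zeros D f = [set y].
Proof.
move=> iF uJ Dz nF F2; have [I uI fI] := null_ex_root qP nF F2.
exists (polar a b I); rewrite (sphere_zeros iF) // predeqE => y; split=> [|->].
  case=> I' [uI' fI'] <- /=; congr polar; apply/eqP; rewrite -subr_eq0.
  (* Subtracting the equations of two roots; there are no zero divisors. *)
  have : (I' - I) ** F.2 (a +i* b) = 0.
    rewrite smulDl smulNl; apply/eqP; rewrite subr_eq0; apply/eqP.
    by apply: (addrI (F.1 (a +i* b))); rewrite fI fI'.
  by move=> /(smul_eq0 qP)[->|/eqP]; rewrite ?eqxx // (negbTE F2).
by exists I.
Qed.

Lemma null_spheres_mul D F G :
  null_spheres D (stem_mul F G) = null_spheres D F `|` null_spheres D G.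
Proof.
rewrite predeqE => x; split.
  case=> a [b [J [uJ Dz -> /(nullM qP) [] n]]]; [left|right];
  by exists a, b, J.
by case=> -[a [b [J [uJ Dz -> n]]]]; exists a, b, J; split=> //;
  apply/(nullM qP); [left|right].
Qed.

Lemma null_spheres_conj D F : null_spheres D (stem_conj F) = null_spheres D F.
Proof.
by rewrite predeqE => x; split=> -[a [b [J [uJ Dz -> n]]]];
  exists a, b, J; split=> //; apply/(null_conj qP).
Qed.

Lemma zeros_normal D f : is_slice D f ->
  zeros D (normal D f) = null_spheres D (stem_of D f).
Proof.
move=> sf; have [_ iF] := stem_ofP sf; have [sFc iFc] := slice_conjP sf.
have sfc : is_slice D (slice_conj D f) by exists (stem_conj (stem_of D f)).
have [_ iN] := slice_mulP sf sfc; have [_ iFc'] := stem_ofP sfc.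
set F := stem_of D f in iF sFc iFc iN *.
(* By [normE] and [polE], both components of the stem of the normal function are real multiples of
   [sone]. *)
have val (a b : R) (J : A) : imunit J -> D (a +i* b) ->
    normal D f (polar a b J) =
    polar (q (F.1 (a +i* b)) - q (F.2 (a +i* b)))
          (pol q (F.1 (a +i* b)) (F.2 (a +i* b))) J.
  move=> uJ Dz; rewrite [LHS]iN // /stem_mul.
  have /= [-> ->] := stem_uniq iFc' iFc uJ Dz.
  rewrite -!(normE qP) -[X in J ** X](polE qP).
  by rewrite smulZr smul1r -scalerBl.
rewrite predeqE => x; split=> [[[a [b [J [uJ Dz ->]]]]]|].
  rewrite val //.
  (* With zero in polar form, [polar_uniq] makes both real coefficients vanish. *)
  have -> : (0 : A) = polar 0 0 J by rewrite /polar !scale0r addr0.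
  move=> /(polar_uniq uJ uJ) [/eqP]; rewrite subr_eq0 => /eqP n0.
  rewrite scale0r => /eqP; rewrite scaler_eq0 => /orP[/eqP p0|/eqP J0].
    by exists a, b, J.
  have /(imunit_normP qP)[] := uJ; rewrite J0 (norm0 qP) => /eqP.
  by rewrite eq_sym oner_eq0.
case=> a [b [J [uJ Dz -> [n0 p0]]]]; split; first by exists a, b, J.
by rewrite val // n0 p0 subrr /polar !scale0r addr0.
Qed.

(** The three cases depend on whether [null] holds and whether the second stem component is zero.
    Conjugation preserves both conditions, so [f] and its conjugate fall in the same case. *)
Lemma slice_zeros D f : is_slice D f ->
  [/\ (forall x, circ D x ->
         [\/ sphere x `&` zeros D f = set0 /\
             sphere x `&` zeros D (slice_conj D f) = set0,
             (exists y, sphere x `&` zeros D f = [set y]) /\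
             (exists y, sphere x `&` zeros D (slice_conj D f) = [set y])
           | sphere x `&` zeros D f = sphere x /\
             sphere x `&` zeros D (slice_conj D f) = sphere x]),
      zeros D (normal D f) = \bigcup_(x in zeros D f) sphere x,
      \bigcup_(x in zeros D f) sphere x =
        \bigcup_(x in zeros D (slice_conj D f)) sphere x
    & forall g, is_slice D g ->
        \bigcup_(x in zeros D (slice_mul D f g)) sphere x =
        \bigcup_(x in zeros D f `|` zeros D g) sphere x].
Proof.
move=> sf; have [_ iF] := stem_ofP sf; have [_ iFc] := slice_conjP sf.
split.
- move=> _ [a [b [J [uJ Dz ->]]]].
  set F := stem_of D f in iF iFc *.
  have nc := null_conj qP (F.1 (a +i* b)) (F.2 (a +i* b)).
  have [nF|nF] := pselect (null q (F.1 (a +i* b)) (F.2 (a +i* b))).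
    have nFc := nc.2 nF.
    have [F20|F20] := eqVneq (F.2 (a +i* b)) 0.
      constructor 3; split; first exact: (sphere_zeros_full iF).
      by apply: (sphere_zeros_full iFc) => //=; rewrite F20 sconj0.
    constructor 2; split; first exact: (sphere_zeros_singleton iF).
    apply: (sphere_zeros_singleton iFc) => //=; apply: contra_neq F20 => F20.
    by rewrite -[LHS]sconjK F20 sconj0.
  constructor 1; split; first exact: (sphere_zeros_empty iF).
  by apply: (sphere_zeros_empty iFc) => //= /nc.
- by rewrite zeros_normal // (bigcup_sphere_zeros iF).
- by rewrite (bigcup_sphere_zeros iF) (bigcup_sphere_zeros iFc) null_spheres_conj.
- move=> g sg; have [_ iG] := stem_ofP sg; have [_ iFG] := slice_mulP sf sg.
  by rewrite bigcup_setU (bigcup_sphere_zeros iF) (bigcup_sphere_zeros iG)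
    (bigcup_sphere_zeros iFG) null_spheres_mul.
Qed.

End SliceOperations.

(** * Norms under Cayley-Dickson doubling *)

Section DoubleNorm.
Variables (R : realType) (A : starAlgType R) (q : A -> R).
Hypothesis qP : multiplicative_norm q.
Hypothesis smulA : associative (@smul R A).
Implicit Types x y z w : A.

Lemma double_smulE (x y : Defs.double A) : x ** y =
  (x.1 ** y.1 - y.2^c ** x.2, y.2 ** x.1 + x.2 ** y.1^c) :> Defs.double A.
Proof. by []. Qed.

Lemma double_conjE (x : Defs.double A) : x^c = (x.1^c, - x.2) :> Defs.double A.
Proof. by []. Qed.

Definition double_norm (x : Defs.double A) : R := q x.1 + q x.2.

(** Multiplication by [y] and by [y^c] are adjoint for [pol]; this uses associativity. *)
Lemma pol_adjr x y z : pol q (x ** y) z = pol q x (z ** y^c).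
Proof.
by apply: (@scale_sone_inj _ A); rewrite /= !(polE qP) !sconjM sconjK !smulA.
Qed.

Lemma pol_adjl x y z : pol q (x ** y) z = pol q y (x^c ** z).
Proof.
by rewrite -(pol_conj qP) sconjM pol_adjr -[RHS](pol_conj qP) sconjM !sconjK.
Qed.

Lemma double_multiplicative_norm : multiplicative_norm double_norm.
Proof.
split.
- by move=> x; rewrite addr_ge0 // (norm_ge0 qP).
- move=> [x y] /eqP; rewrite /double_norm paddr_eq0 ?(norm_ge0 qP) //=.
  by move=> /andP[/eqP/(norm_eq0 qP) -> /eqP/(norm_eq0 qP) ->].
- move=> [a b] [c d]; rewrite double_smulE /double_norm /=.
  rewrite !normD (normN qP) (polNr qP) !(normM qP) !(norm_conj qP).
  (* The polar terms of the two components have opposite signs, so they cancel once seen to be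
     equal. *)
  have -> : pol q (d ** a) (b ** c^c) = pol q (a ** c) (d^c ** b).
    by rewrite pol_adjl [RHS]pol_adjr smulA.
  ring.
- by move=> [a b]; rewrite /double_norm /= (norm_conj qP) (normN qP).
move=> [a b] [c d]; rewrite !double_smulE double_conjE /double_norm /=.
have conjl w : w^c ** w = q w *: sone.
  by rewrite -[X in _ ** X]sconjK -(normE qP) (norm_conj qP).
(* In each component the mixed terms cancel and the others collect the factor [q c + q d]. *)
apply/pair_equal_spec; split=> /=.
- rewrite sconjN smulNl opprK smulDl smulNl smulDr !smulA -(smulA a) -(normE qP).
  rewrite conjl smulZl smulZr smul1l smul1r addrACA addNr addr0.
  by rewrite -scalerDl.
rewrite sconjK smulNl smulDr smulDl smulNr !smulA -(normE qP) -(smulA b) conjl.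
rewrite smulZl smulZr smul1l smul1r opprD opprK addrACA.
by rewrite addNr add0r -scalerDl [q d + _]addrC.
Qed.

End DoubleNorm.

(** * The norms of the complex numbers, quaternions and octonions *)

Section CHONorm.
Variable R : realType.

Definition Rcomplex_norm (x : Rcomplex R) : R :=
  complex.Re x ^+ 2 + complex.Im x ^+ 2.

Lemma Rcomplex_smulA : associative (@smul R (Rcomplex R)).
Proof. exact: mulrA. Qed.

Lemma Rcomplex_multiplicative_norm : multiplicative_norm Rcomplex_norm.
Proof.
split; rewrite /Rcomplex_norm.
- by move=> x; rewrite addr_ge0 // sqr_ge0.
- move=> [a b] /eqP /=; rewrite paddr_eq0 ?sqr_ge0 // !sqrf_eq0.
  by move=> /andP[/eqP -> /eqP ->].
- by move=> [a b] [c d] /=; ring.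
- by move=> [a b] /=; ring.
by move=> [a b] [c d]; congr Complex => /=; ring.
Qed.

Lemma quaternion_smulA : associative (@smul R (quaternion R)).
Proof.
move=> [[a1 a2] [b1 b2]] [[c1 c2] [d1 d2]] [[e1 e2] [g1 g2]].
by apply/pair_equal_spec; split; congr Complex => /=; ring.
Qed.

(** Two doublings of the squared modulus. Each uses associativity of the algebra being doubled, not
    of the result, so the octonions are reached. *)
Lemma CHO_multiplicative_norm (k : CHO) :
  exists q : CHO_alg R k -> R, multiplicative_norm q.
Proof.
have qC := Rcomplex_multiplicative_norm.
have qH := double_multiplicative_norm qC Rcomplex_smulA.
have qO := double_multiplicative_norm qH quaternion_smulA.
by case: k; [exists Rcomplex_norm | eexists; exact: qH | eexists; exact: qO].
Qed.

End CHONorm.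

Theorem theorem3p2 (R : realType) (k : CHO) (D : set (complex R))
    (D_neq0 : D !=set0) (D_conj : conj_invariant D)
    (f : CHO_alg R k -> CHO_alg R k) (f_slice : is_slice D f) :
  [/\ (forall x, circ D x ->
         [\/ sphere x `&` zeros D f = set0 /\
             sphere x `&` zeros D (slice_conj D f) = set0,
             (exists y, sphere x `&` zeros D f = [set y]) /\
             (exists y, sphere x `&` zeros D (slice_conj D f) = [set y])
           | sphere x `&` zeros D f = sphere x /\
             sphere x `&` zeros D (slice_conj D f) = sphere x]),
      zeros D (normal D f) = \bigcup_(x in zeros D f) sphere x,
      \bigcup_(x in zeros D f) sphere x =
        \bigcup_(x in zeros D (slice_conj D f)) sphere x
    & forall g : CHO_alg R k -> CHO_alg R k, is_slice D g ->
        \bigcup_(x in zeros D (slice_mul D f g)) sphere x =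
        \bigcup_(x in zeros D f `|` zeros D g) sphere x].
Proof.
by have [q qP] := CHO_multiplicative_norm R k; exact: slice_zeros qP _ _ f_slice.
Qed.
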